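(* Let $\Pi=\{\pi_n\}$ be a sequence of partitions of $[0,T]$ with vanishing mesh. Let $\alpha\in(\frac13,1]$ and $\gamma>0$ satisfy $\gamma+3\alpha>1$, and let $z=(z^1,\dots,z^K)\in C^{\alpha}([0,T];\mathbb{R}^K)\cap\mathcal{V}^{\gamma}_{\Pi}([0,T];\mathbb{R}^K)$. If $y\in\mathscr{D}^{2\alpha}_z([0,T];\mathbb{R})$ is controlled by $z$ with Gubinelli derivative $y'=(y^1,\dots,y^K)$ and remainder $y^\sharp$, then $y\in\mathcal{V}^{\gamma}_{\Pi}([0,T];\mathbb{R})$ and for all $t\in[0,T]$, $$\langle y\rangle^{(\gamma)}_t=\sum_{k,l=1}^K\int_0^t y^k_r\,y^l_r\,\mathrm{d}\langle z^k,z^l\rangle^{(\gamma)}_r .$$ Moreover, for all $t\in[0,T]$ and $\epsilon>0$, $$\langle y\rangle^{(\gamma),n}_t-\sum_{k,l=1}^K\int_0^t y^k_r y^l_r\,\mathrm{d}\langle z^k,z^l\rangle^{(\gamma)}_r=\mathcal{O}_C\Big(|\pi_n|^{\gamma+3\alpha-1}+\max_{1\le k,l\le K}\big\|\langle z^k,z^l\rangle^{(\gamma),n}-\langle z^k,z^l\rangle^{(\gamma)}\big\|_{\infty,[0,t]}^{\alpha-\epsilon}\Big),$$ where $C=C(\alpha,K,T,\|z\|_\alpha,\langle\langle z\rangle\rangle^{(\gamma)}_T,\|y'\|_\alpha,[y^\sharp]_{2\alpha})$.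
   Context: Partitions: a partition $\pi$ of $[0,T]$ is given by $0=t_0<t_1<\dots<t_{\#\pi}=T$ and identified with the set of its intervals $[t_i,t_{i+1}]$; $|\pi|=\max_i(t_{i+1}-t_i)$; $\pi\cap[0,t]$ is the set of intervals of $\pi$ contained in $[0,t]$. A sequence $\Pi=\{\pi_n\}$ has vanishing mesh if $|\pi_n|\to0$. Write $\delta x_{st}=x_t-x_s$. Scaled variation: for $\gamma\in\mathbb{R}$ and $x,z:[0,T]\to\mathbb{R}$, $\langle x,z\rangle^{(\gamma),n}_t=\sum_{[t_i,t_{i+1}]\in\pi_n\cap[0,t]}(t_{i+1}-t_i)^\gamma\,\delta x_{t_it_{i+1}}\,\delta z_{t_it_{i+1}}$, and $\langle x\rangle^{(\gamma),n}=\langle x,x\rangle^{(\gamma),n}$. $\mathcal{V}^\gamma_\Pi([0,T];\mathbb{R}^d)$ is the set of paths $x=(x^1,\dots,x^d)$ such that for all $i,j$ the limit $\langle x^i,x^j\rangle^{(\gamma)}_t=\lim_{n}\langle x^i,x^j\rangle^{(\gamma),n}_t$ exists for all $t\in[0,T]$ and is a continuous function of bounded variation in $t$. Write $\langle x\rangle^{(\gamma)}=\langle x,x\rangle^{(\gamma)}$ for scalar $x$, and $\langle\langle x\rangle\rangle^{(\gamma)}=\sum_{i}\langle x^i\rangle^{(\gamma)}$. Hölder spaces: $[f]_\alpha=\sup_{s\ne t}|\delta f_{st}|/|t-s|^\alpha$, $\|f\|_\alpha=\|f\|_\infty+[f]_\alpha$; for $f$ defined on $\Delta_T=\{(s,t)\in[0,T]^2:s\le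 t\}$, $[f]_\alpha=\sup_{s<t}|f_{st}|/|t-s|^\alpha$ and $C^\alpha_2$ denotes those $f$ with $[f]_\alpha<\infty$. Controlled paths: $y\in C^\alpha([0,T];\mathbb{R}^d)$ is controlled by $z\in C^\alpha([0,T];\mathbb{R}^K)$, written $y\in\mathscr{D}^{2\alpha}_z([0,T];\mathbb{R}^d)$, if there is $y'\in C^\alpha([0,T];\mathbb{R}^{d\times K})$ (the Gubinelli derivative) such that the remainder $y^\sharp_{st}=\delta y_{st}-y'_s\,\delta z_{st}$ belongs to $C^{2\alpha}_2([0,T];\mathbb{R}^d)$. Convention: $a_n=\mathcal{O}_C(b_n)$ with $C=C(q_1,\dots,q_m)$ means that there are a finite constant $C$ depending only on $q_1,\dots,q_m$ (and on $\epsilon$ and the fixed exponents and dimensions) and an $n_0$ such that $|a_n|\le C\,b_n$ for all $n\ge n_0$. $\|\cdot\|_{\infty,[0,t]}$ is the supremum norm on $[0,t]$. *)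

(* Defs.v *)
From HB Require Import structures.
From mathcomp Require Import all_boot all_order all_algebra.
From mathcomp Require Import all_classical all_reals all_analysis.

Set Implicit Arguments.
Unset Strict Implicit.
Unset Printing Implicit Defensive.

Import Order.TTheory GRing.Theory Num.Theory.
Import numFieldNormedType.Exports.

Local Open Scope classical_set_scope.
Local Open Scope ring_scope.

(* As in [itv_partition], a partition a = t_0 < t_1 < ... < t_m = b of [a, b]
   is represented by the sequence s = [:: t_1; ...; t_m], with m = size s.
   All paths are functions on R of which only the values on [0, T] matter. *)
Section Partitions.
Variable R : realType.
Implicit Types (a b : R) (s : seq R).

Definition node a s (i : nat) : R := nth 0 (a :: s) i.

Definition mesh a s : R :=
  \big[Num.max/0]_(i < size s) (node a s i.+1 - node a s i).

Definition vanishing_partitions (T : R) (Pi : nat -> seq R) : Prop :=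
  (forall n, itv_partition 0 T (Pi n)) /\
  (fun n => mesh 0 (Pi n)) @ \oo --> (0 : R).

(* Riemann-Stieltjes integral of f against g; for f continuous and g continuous
   of bounded variation it agrees with the Lebesgue-Stieltjes one. *)
Definition is_RSint (f g : R -> R) a b (I : R) : Prop :=
  forall e : R, 0 < e -> exists2 d : R, 0 < d &
  forall (s : seq R) (xi : nat -> R),
    itv_partition a b s -> mesh a s < d ->
    (forall i, (i < size s)%N -> node a s i <= xi i <= node a s i.+1) ->
    `| \sum_(i < size s) f (xi i) * (g (node a s i.+1) - g (node a s i)) - I |
      < e.

Definition RS_integrable (f g : R -> R) a b : Prop :=
  exists I, is_RSint f g a b I.

Definition RSint (f g : R -> R) a b : R := xget 0 [set I | is_RSint f g a b I].

End Partitions.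

Section ScaledVariation.
Variable R : realType.
Implicit Types (Pi : nat -> seq R) (gamma T t : R).

(* As 0 <= t_i, the interval [t_i, t_(i+1)] lies in [0, t] iff t_(i+1) <= t. *)
Definition scaled_cov_n Pi gamma (x z : R -> R) (n : nat) t : R :=
  \sum_(i < size (Pi n) | node 0 (Pi n) i.+1 <= t)
    (node 0 (Pi n) i.+1 - node 0 (Pi n) i) `^ gamma
    * (x (node 0 (Pi n) i.+1) - x (node 0 (Pi n) i))
    * (z (node 0 (Pi n) i.+1) - z (node 0 (Pi n) i)).

Definition scaled_cov Pi gamma (x z : R -> R) t : R :=
  lim ((fun n => scaled_cov_n Pi gamma x z n t) @ \oo).

Definition coord_path d (x : R -> 'cV[R]_d) (i : 'I_d) : R -> R :=
  fun t => x t i 0.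

Definition scaled_var_path Pi gamma T d (x : R -> 'cV[R]_d) : Prop :=
  forall i j : 'I_d, [/\
    forall t, 0 <= t <= T ->
      cvgn (fun n => scaled_cov_n Pi gamma (coord_path x i) (coord_path x j) n t),
    {within `[0, T],
      continuous (scaled_cov Pi gamma (coord_path x i) (coord_path x j))} &
    bounded_variation 0 T
      (scaled_cov Pi gamma (coord_path x i) (coord_path x j))].

Definition total_scaled_var Pi gamma d (x : R -> 'cV[R]_d) t : R :=
  \sum_(i < d) scaled_cov Pi gamma (coord_path x i) (coord_path x i) t.

End ScaledVariation.

(* For paths in R^d or in R^(d x K), `|.| is the maximum norm over the
   entries. *)
Section Holder.
Variables (R : realType) (V : normedModType R).
Implicit Types (T alpha : R).

Definition sup_norm T (f : R -> V) : R :=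
  sup [set q | exists2 t, 0 <= t <= T & q = `|f t|].

Definition holder_quotients T alpha (f : R -> V) : set R :=
  [set q | exists s t, [/\ 0 <= s <= T, 0 <= t <= T, s != t &
                           q = `|f t - f s| / `|t - s| `^ alpha]].

Definition holder T alpha (f : R -> V) : Prop :=
  has_ubound (holder_quotients T alpha f).

Definition holder_seminorm T alpha (f : R -> V) : R :=
  sup (holder_quotients T alpha f).

Definition holder_norm T alpha (f : R -> V) : R :=
  sup_norm T f + holder_seminorm T alpha f.

Definition holder2_quotients T alpha (f : R -> R -> V) : set R :=
  [set q | exists s t, [/\ 0 <= s, s < t, t <= T &
                           q = `|f s t| / `|t - s| `^ alpha]].

Definition holder2 T alpha (f : R -> R -> V) : Prop :=
  has_ubound (holder2_quotients T alpha f).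

Definition holder2_seminorm T alpha (f : R -> R -> V) : R :=
  sup (holder2_quotients T alpha f).

End Holder.

Section Controlled.
Variables (R : realType) (d K : nat).
Implicit Types (T alpha : R).

Definition remainder (z : R -> 'cV[R]_K) (y : R -> 'cV[R]_d)
    (y' : R -> 'M[R]_(d, K)) (s t : R) : 'cV[R]_d :=
  y t - y s - y' s *m (z t - z s).

Definition controlled T alpha (z : R -> 'cV[R]_K) (y : R -> 'cV[R]_d)
    (y' : R -> 'M[R]_(d, K)) : Prop :=
  [/\ holder T alpha y, holder T alpha y' &
      holder2 T (2 * alpha) (remainder z y y')].

End Controlled.

(* A scalar path seen as a path in R^1. *)
Definition path1 (R : realType) (y : R -> R) : R -> 'cV[R]_1 :=
  fun t => (y t)%:M.

(* Main.v *)
Require Import Defs.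
From HB Require Import structures.
From mathcomp Require Import all_boot all_order all_algebra.
From mathcomp Require Import all_classical all_reals all_analysis.
From mathcomp Require Import ring lra.

Import Order.TTheory GRing.Theory Num.Theory.
Import numFieldNormedType.Exports.

Local Open Scope classical_set_scope.
Local Open Scope ring_scope.

Set Implicit Arguments.
Unset Strict Implicit.
Unset Printing Implicit Defensive.

(** Write A^n and A for the scaled covariation of (z^k, z^l) along pi_n and its
    limit, f = y^k y^l, and w_i for the jump of A^n at the node t_(i+1).

    Reduction to z. On an interval of length h, the increment of y is
    y' . dz + O(h^(2 alpha)) while dz = O(h^alpha), so its square is the sum
    over k, l of f dz^k dz^l up to O(h^(3 alpha)); replacing f(t_i) by f(t_(i+1))
    costs the same, f being alpha-Holder. After weighting by h^gamma and
    summing, the total error is O(T |pi_n|^(gamma + 3 alpha - 1))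
    ([controlled_sqr_increment], [scaled_var_weighted_cov]). Evaluating f at the
    right end point makes F^n(t) = sum over t_(i+1) <= t of f(t_(i+1)) w_i
    exactly the integral of f against the step function A^n.

    Convergence of F^n. Let G^n be the sum over k of the scaled variations of
    z^k. It is nondecreasing and dominates A^n, whence
      |F^n(b) - F^n(a) - f(a) (A^n(b) - A^n(a))|
        <= H (b - a)^alpha (G^n(b) - G^n(a)),
    a relation called [sewn] below. Summing it over a fixed grid of [0, t] shows
    that F^n(t) is, uniformly in n, close to a finite combination of values of
    A^n, which converge; so F^n(t) is a Cauchy sequence ([sewn_cvg]). The
    relation is preserved by pointwise limits ([sewn_lim]), and any F which
    satisfies it is the Riemann-Stieltjes integral of f against A, because the
    errors over the intervals of a partition of small mesh add up to
    something small ([sewn_is_RSint]). So the integral exists because F^n has a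
    limit, and is that limit.

    Rate. The difference F^n - F is sewn for the integrator D = A^n - A. On a
    grid of [0, t] of step about eta, where |D| <= eta, the sewing error is
    O(eta^alpha), and summation by parts bounds the sum of f dD by
    O(eta + (1/eta) eta^alpha eta) = O(eta^alpha) ([sewn_le_sup], [sewn_rate]).
    Since eta is bounded by a constant, eta^alpha = O(eta^(alpha - epsilon)). *)

(** * Powers and grids of small step *)

Lemma powR_small (R : realType) (alpha e : R) : 0 < alpha -> 0 < e ->
  exists2 d : R, 0 < d & forall x, 0 <= x -> x <= d -> x `^ alpha <= e.
Proof.
move=> alpha_gt0 e_gt0; exists (e `^ alpha^-1); first exact: powR_gt0.
move=> x x_ge0 xd; have -> : e = (e `^ alpha^-1) `^ alpha.
  by rewrite -powRrM mulVf ?gt_eqF// powRr1// ltW.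
by apply: ge0_ler_powR; rewrite ?nnegrE ?powR_ge0// ltW.
Qed.

Lemma exists_div_nat_le (R : realType) (t d : R) : 0 <= t -> 0 < d ->
  exists2 m : nat, (0 < m)%N & t / m%:R <= d.
Proof.
move=> t_ge0 d_gt0; exists (Num.trunc (t / d)).+1 => //.
rewrite ler_pdivrMr ?ltr0n// mulrC -ler_pdivrMr//.
exact/ltW/truncnS_gt.
Qed.

(** * Nodes of a partition *)

Section Nodes.
Variable R : realType.
Implicit Types (a b : R) (s : seq R).

Lemma node0 a s : node a s 0 = a. Proof. by []. Qed.

Lemma node_size a b s : itv_partition a b s -> node a s (size s) = b.
Proof. exact: itv_partition_nth_size. Qed.

Lemma node_le a b s i j : itv_partition a b s -> (i <= j <= size s)%N ->
  node a s i <= node a s j.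
Proof.
move=> [pa _] /andP[ij js]; apply: (@sorted_leq_nth _ <=%O).
- exact: le_trans.
- exact: lexx.
- by apply: sub_path pa => x y /ltW.
- by rewrite inE /= ltnS (leq_trans ij).
- by rewrite inE /= ltnS.
- exact: ij.
Qed.

Lemma node_bounds a b s i : itv_partition a b s -> (i <= size s)%N ->
  a <= node a s i <= b.
Proof.
move=> ps si; rewrite -{1}(node0 a s) -(node_size ps).
by rewrite !(node_le ps)//= ?si//= ?leqnn.
Qed.

Lemma node_step_le_mesh a s i : (i < size s)%N ->
  node a s i.+1 - node a s i <= mesh a s.
Proof.
move=> si; exact: (le_bigmax 0
  (fun i : 'I_(size s) => node a s i.+1 - node a s i) (Ordinal si)).
Qed.

Lemma mesh_ge0 a s : 0 <= mesh a s.
Proof.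
by rewrite /mesh; elim/big_rec: _ => // i x _; rewrite le_max orbC => ->.
Qed.

Lemma sum_node_steps a b s (g : R -> R) : itv_partition a b s ->
  \sum_(i < size s) (g (node a s i.+1) - g (node a s i)) = g b - g a.
Proof.
move=> ps.
rewrite -(big_mkord xpredT (fun i => g (node a s i.+1) - g (node a s i))).
by rewrite (telescope_sumr (fun i => g (node a s i))) // (node_size ps).
Qed.

End Nodes.

Lemma node_gt (R : realType) (a b : R) s i : itv_partition a b s ->
  (i < size s)%N -> a < node a s i.+1.
Proof.
move=> [+ _] si; rewrite (path_sortedE lt_trans) => /andP[/all_nthP + _].
by move=> /(_ 0 i si).
Qed.

Lemma node_ltS (R : realType) (a b : R) s i : itv_partition a b s ->
  (i < size s)%N -> node a s i < node a s i.+1.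
Proof. by move=> [/(pathP 0) ps _] /ps. Qed.

(** One power of each step is kept to sum to b - a, the others are bounded by the
    mesh. *)
Lemma sum_powR_steps (R : realType) (a b : R) s (theta : R) :
  itv_partition a b s -> 0 < theta ->
  \sum_(i < size s) (node a s i.+1 - node a s i) `^ (1 + theta)
    <= (b - a) * mesh a s `^ theta.
Proof.
move=> ps theta_gt0; rewrite -(sum_node_steps id ps) mulr_suml.
apply: ler_sum => i _; have si := ltn_ord i.
have h_ge0 : 0 <= node a s i.+1 - node a s i.
  by rewrite subr_ge0 (node_le ps)// leqnSn.
rewrite powRD; last by rewrite gt_eqF// addr_gt0.
rewrite powRr1// ler_wpM2l// ge0_ler_powR ?nnegrE ?mesh_ge0 ?(ltW theta_gt0)//.
exact: node_step_le_mesh.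
Qed.

(** * Equidistant partitions *)

Section Grid.
Variable R : realType.
Implicit Types (t : R) (m j : nat).

Definition grid t m j : R := t * j%:R / m%:R.

Lemma grid0 t m : grid t m 0 = 0.
Proof. by rewrite /grid mulr0 mul0r. Qed.

Lemma grid_last t m : (0 < m)%N -> grid t m m = t.
Proof. by move=> m_gt0; rewrite /grid mulfK// pnatr_eq0 -lt0n. Qed.

Lemma grid_step t m j : grid t m j.+1 - grid t m j = t / m%:R.
Proof. by rewrite /grid -mulrBl -mulrBr -natrB// subSnn mulr1. Qed.

Lemma grid_bounds t m j : 0 <= t -> (j <= m)%N -> 0 <= grid t m j <= t.
Proof.
move=> t_ge0 jm; have [->|m_gt0] := posnP m.
  by rewrite /grid invr0 mulr0 lexx t_ge0.
rewrite /grid divr_ge0 ?mulr_ge0//= -mulrA ler_piMr//.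
by rewrite ler_pdivrMr ?ltr0n// mul1r ler_nat.
Qed.

Lemma grid_leS t m j : 0 <= t -> grid t m j <= grid t m j.+1.
Proof.
by move=> t_ge0; rewrite -(subrK (grid t m j) (grid t m j.+1)) grid_step
  lerDr divr_ge0.
Qed.

Lemma grid_ltS t m j : 0 < t -> (0 < m)%N -> grid t m j < grid t m j.+1.
Proof.
by move=> t_gt0 m_gt0; rewrite -(subrK (grid t m j) (grid t m j.+1)) grid_step
  ltrDr divr_gt0// ltr0n.
Qed.

Definition grid_seq t m : seq R := mkseq (fun j => grid t m j.+1) m.

Lemma node_grid_seq t m j : (j <= m)%N -> node 0 (grid_seq t m) j = grid t m j.
Proof.
by case: j => [|j] jm; rewrite /node /= ?grid0// nth_mkseq.
Qed.

Lemma grid_seq_partition t m : 0 < t -> (0 < m)%N ->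
  itv_partition 0 t (grid_seq t m).
Proof.
move=> t_gt0 m_gt0; split.
  apply/(pathP 0) => i; rewrite size_mkseq => im.
  rewrite -/(node 0 _ i) node_grid_seq 1?ltnW// nth_mkseq//.
  exact: grid_ltS.
rewrite (last_nth 0) size_mkseq -/(node 0 _ m) node_grid_seq//.
by rewrite grid_last.
Qed.

Lemma mesh_grid_seq t m : 0 <= t -> mesh 0 (grid_seq t m) <= t / m%:R.
Proof.
move=> t_ge0; rewrite /mesh size_mkseq; apply: bigmax_le => [|i _].
  by rewrite divr_ge0.
by rewrite !node_grid_seq ?grid_step // ltnW.
Qed.

Lemma sum_grid_steps t m (g : R -> R) : (0 < m)%N ->
  \sum_(j < m) (g (grid t m j.+1) - g (grid t m j)) = g t - g 0.
Proof.
move=> m_gt0.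
rewrite -(big_mkord xpredT (fun j => g (grid t m j.+1) - g (grid t m j))).
by rewrite (telescope_sumr (fun j => g (grid t m j)))// grid_last// grid0.
Qed.

End Grid.

(** * Uniqueness of the Riemann-Stieltjes integral *)

Section RiemannStieltjes.
Variable R : realType.
Implicit Types (f g : R -> R) (t : R).

(** The definition quantifies over partitions of mesh less than d; such
    partitions exist, so two integrals are both close to one common Riemann
    sum. The empty partition serves for t = 0. *)
Lemma is_RSint_unique f g t I1 I2 : 0 <= t ->
  is_RSint f g 0 t I1 -> is_RSint f g 0 t I2 -> I1 = I2.
Proof.
move=> t_ge0 int1 int2; apply/eqP; rewrite -subr_eq0; apply/negP => /negP I12.
have e_gt0 : 0 < `|I1 - I2| / 2 by rewrite divr_gt0// normr_gt0.
have [d1 d1_gt0 H1] := int1 _ e_gt0; have [d2 d2_gt0 H2] := int2 _ e_gt0.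
have [s [ps sd1 sd2]] : exists s, [/\ itv_partition 0 t s,
    mesh 0 s < d1 & mesh 0 s < d2].
  move: t_ge0; rewrite le_eqVlt => /predU1P[<-|t_gt0].
    by exists [::]; split; rewrite /mesh ?big_ord0//; split.
  have d_gt0 : 0 < Num.min d1 d2 by rewrite lt_min d1_gt0.
  have [m m_gt0 tm] := exists_div_nat_le (ltW t_gt0) (divr_gt0 d_gt0 (ltr0Sn R 1)).
  have {}tm : t / m%:R < Num.min d1 d2.
    by apply: le_lt_trans tm _; rewrite ltr_pdivrMr// ltr_pMr ?ltr1n.
  have /le_lt_trans/(_ tm) : mesh 0 (grid_seq t m) <= t / m%:R.
    by apply: mesh_grid_seq; exact: ltW.
  rewrite lt_min => /andP[md1 md2].
  by exists (grid_seq t m); split => //; exact: grid_seq_partition.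
have xiP i : (i < size s)%N -> node 0 s i <= node 0 s i <= node 0 s i.+1.
  by move=> si; rewrite lexx (node_le ps)// leqnSn.
have := ltrD (H1 s _ ps sd1 xiP) (H2 s _ ps sd2 xiP).
rewrite -splitr ltNge => /negP; apply.
rewrite [X in _ <= X + _]distrC; apply: le_trans (ler_normD _ _).
by rewrite addrA subrK.
Qed.

Lemma RSint_eq f g t I : 0 <= t -> is_RSint f g 0 t I -> RSint f g 0 t = I.
Proof.
move=> t_ge0 int; apply: xget_unique => // I' int'.
exact: is_RSint_unique int' int.
Qed.

End RiemannStieltjes.

(** * Functions sewn from f dA *)

Section Sewing.
Variables (R : realType) (T alpha : R).
Hypotheses (T_ge0 : 0 <= T) (alpha_gt0 : 0 < alpha).
Implicit Types (f A G F D : R -> R) (H : R).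

Definition holder_bound H f := forall s t, 0 <= s -> s <= t -> t <= T ->
  `|f t - f s| <= H * (t - s) `^ alpha.

Definition dominated A G := forall a b, 0 <= a -> a <= b -> b <= T ->
  `|A b - A a| <= G b - G a.

(** The estimate of the sewing lemma, which singles out the indefinite integrals
    of f against A: the error carries both the increment of a control G, which
    adds up over a partition, and a factor that vanishes with the mesh. *)
Definition sewn H f A G F := forall a b, 0 <= a -> a <= b -> b <= T ->
  `|F b - F a - f a * (A b - A a)| <= H * (b - a) `^ alpha * (G b - G a).

Lemma dominated_mono A G a b : dominated A G -> 0 <= a -> a <= b -> b <= T ->
  G a <= G b.
Proof.
by move=> AG a_ge0 ab bT; rewrite -subr_ge0 (le_trans _ (AG _ _ a_ge0 ab bT)).
Qed.

(** The control G is additive over intervals, so the local errors on the grid add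
    up to a bound that still carries the factor (t / m)^alpha. *)
Lemma sewn_grid_sum H f A G F t m : sewn H f A G F ->
  0 <= t <= T -> (0 < m)%N ->
  `|F t - F 0 - \sum_(j < m) f (grid t m j) *
                  (A (grid t m j.+1) - A (grid t m j))|
    <= H * (t / m%:R) `^ alpha * (G t - G 0).
Proof.
move=> sF /andP[t_ge0 tT] m_gt0.
rewrite -(sum_grid_steps t F m_gt0) -(sum_grid_steps t G m_gt0).
rewrite -sumrB mulr_sumr; apply: le_trans (ler_norm_sum _ _ _) _.
apply: ler_sum => j _; rewrite -(grid_step t m j).
have /andP[g0 _] := grid_bounds t_ge0 (ltnW (ltn_ord j)).
have /andP[_ gt] := grid_bounds t_ge0 (ltn_ord j).
by apply: sF => //; [exact: grid_leS | exact: le_trans gt tT].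
Qed.

(** The Riemann sum minus F t - F 0 splits along the partition. On each interval
    [a, b], replacing the tag by a costs the oscillation of f times the increment
    of G, and replacing f(a) (A b - A a) by F b - F a costs the sewing error;
    both are at most H (mesh)^alpha (G b - G a), which telescopes. *)
Lemma sewn_is_RSint H f A G F t : 0 <= H -> holder_bound H f ->
  dominated A G -> sewn H f A G F -> 0 <= t <= T ->
  is_RSint f A 0 t (F t - F 0).
Proof.
move=> H_ge0 fH AG sF /andP[t_ge0 tT] e e_gt0.
have Gt_ge0 : 0 <= G t - G 0 by rewrite subr_ge0 (dominated_mono AG).
(* The term 1 keeps c positive when G is constant on [0, t]. *)
pose c := 2 * H * (G t - G 0) + 1.
have c_gt0 : 0 < c by rewrite ltr_wpDl// !mulr_ge0.
have [d d_gt0 dP] := powR_small alpha_gt0 (divr_gt0 e_gt0 c_gt0).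
exists d => // s xi ps sd xiP.
rewrite -(sum_node_steps F ps) -sumrB.
apply: (@le_lt_trans _ _ (2 * H * (e / c) * (G t - G 0))); last first.
  rewrite mulrAC mulrA ltr_pdivrMr// mulrC ltr_pM2l// /c; lra.
rewrite -(sum_node_steps G ps) mulr_sumr; apply: le_trans (ler_norm_sum _ _ _) _.
apply: ler_sum => i _.
have si := ltn_ord i.
have /andP[a_ge0 _] := node_bounds ps (ltnW si).
have /andP[_ bt] := node_bounds ps si.
have ab : node 0 s i <= node 0 s i.+1 by rewrite (node_le ps)// leqnSn.
have /andP[ax xb] := xiP _ si.
set a := node 0 s i in a_ge0 ab ax *; set b := node 0 s i.+1 in bt ab xb *.
have bT := le_trans bt tT.
have bad : b - a <= d by apply: le_trans (ltW sd); exact: node_step_le_mesh.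
have dG := AG _ _ a_ge0 ab bT.
have dG0 : 0 <= G b - G a := le_trans (normr_ge0 _) dG.
have -> : f (xi i) * (A b - A a) - (F b - F a) =
  (f (xi i) - f a) * (A b - A a) - (F b - F a - f a * (A b - A a)) by ring.
apply: le_trans (ler_normB _ _) _.
have -> : 2 * H * (e / c) * (G b - G a) =
  H * (e / c) * (G b - G a) + H * (e / c) * (G b - G a) by ring.
apply: lerD.
  rewrite normrM ler_pM//; apply: le_trans (fH _ _ a_ge0 ax (le_trans xb bT)) _.
  rewrite ler_wpM2l// dP ?subr_ge0//; apply: le_trans bad.
  by rewrite lerB.
apply: le_trans (sF _ _ a_ge0 ab bT) _.
by rewrite ler_wpM2r// ler_wpM2l// dP// subr_ge0.
Qed.

Lemma cvg_grid_sum f (An : nat -> R -> R) A t m : 0 <= t <= T -> (0 < m)%N ->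
  (forall s, 0 <= s <= T -> An n s @[n --> \oo] --> A s) ->
  \sum_(j < m) f (grid t m j) * (An n (grid t m j.+1) - An n (grid t m j))
    @[n --> \oo] -->
  \sum_(j < m) f (grid t m j) * (A (grid t m j.+1) - A (grid t m j)).
Proof.
move=> /andP[t_ge0 tT] m_gt0 AnA; apply: cvg_big => [|j _].
  exact: add_continuous.
have inT i : (i <= m)%N -> 0 <= grid t m i <= T.
  move=> im; have /andP[-> gt]/= := grid_bounds t_ge0 im.
  exact: le_trans tT.
apply: cvgM; first exact: cvg_cst.
by apply: cvgB; apply: AnA; rewrite inT// ltnW.
Qed.

(** For a fixed grid, [sewn_grid_sum] puts Fn n t within a distance of order
    (t / m)^alpha, uniformly in n, of a sum that converges as n grows; hence the
    sequence is Cauchy. *)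
Lemma sewn_cvg H f (An Gn Fn : nat -> R -> R) A G t : 0 <= H ->
  (forall n, sewn H f (An n) (Gn n) (Fn n)) ->
  (forall n, Fn n 0 = 0) -> (forall n, Gn n 0 = 0) ->
  (forall s, 0 <= s <= T -> An n s @[n --> \oo] --> A s) ->
  (forall s, 0 <= s <= T -> Gn n s @[n --> \oo] --> G s) ->
  0 <= t <= T -> cvgn (fun n => Fn n t).
Proof.
move=> H_ge0 sFn Fn0 Gn0 AnA GnG tT; have /andP[t_ge0 _] := tT.
apply/cauchy_cvgP/cauchy_exP => e e_gt0.
pose c := H * (`|G t| + 1) + 1.
have c_gt0 : 0 < c by rewrite ltr_wpDl// mulr_ge0// addr_ge0.
have ec_gt0 : 0 < e / 2 / c by rewrite !divr_gt0.
have [d d_gt0 dP] := powR_small alpha_gt0 ec_gt0.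
have [m m_gt0 tm] := exists_div_nat_le t_ge0 d_gt0.
pose L := \sum_(j < m) f (grid t m j) * (A (grid t m j.+1) - A (grid t m j)).
exists L.
have /cvgrPdist_lt/(_ (e / 2)) := cvg_grid_sum (f := f) tT m_gt0 AnA.
rewrite divr_gt0// => /(_ isT) nearL.
have /cvgrPdist_lt/(_ 1 ltr01) nearG := GnG _ tT.
rewrite /nbhs/= /nbhs/=.
suff : \forall n \near \oo, ball L e (Fn n t) by [].
near=> n; rewrite /ball/=.
set Ln := \sum_(j < m) f (grid t m j) *
  (An n (grid t m j.+1) - An n (grid t m j)).
have LLn : `|L - Ln| < e / 2 by rewrite /Ln; near: n.
have Gnt : `|Gn n t| <= `|G t| + 1.
  have : `|G t - Gn n t| < 1 by near: n.
  rewrite distrC => /ltW /(le_trans (lerB_dist _ _)).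
  by rewrite lerBlDl addrC.
have := sewn_grid_sum (sFn n) tT m_gt0.
rewrite Fn0 Gn0 !subr0 -/Ln => FLn.
have {}FLn : `|Fn n t - Ln| < e / 2.
  apply: le_lt_trans FLn _.
  apply: (@le_lt_trans _ _ (H * (e / 2 / c) * (`|G t| + 1))).
    apply: (@le_trans _ _ (H * (t / m%:R) `^ alpha * (`|G t| + 1))).
      rewrite ler_wpM2l ?mulr_ge0 ?powR_ge0//.
      exact: le_trans (ler_norm _) Gnt.
    rewrite ler_wpM2r ?addr_ge0// ler_wpM2l// dP//.
    by rewrite divr_ge0.
  rewrite mulrAC mulrA ltr_pdivrMr// mulrC ltr_pM2l ?divr_gt0// /c; lra.
have -> : L - Fn n t = (L - Ln) - (Fn n t - Ln) by ring.
rewrite (le_lt_trans (ler_normB _ _))// (splitr e) ltrD//.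
Unshelve. all: by end_near. Qed.

Lemma sewn_lim H f (An Gn Fn : nat -> R -> R) A G F :
  (forall n, sewn H f (An n) (Gn n) (Fn n)) ->
  (forall s, 0 <= s <= T -> An n s @[n --> \oo] --> A s) ->
  (forall s, 0 <= s <= T -> Gn n s @[n --> \oo] --> G s) ->
  (forall s, 0 <= s <= T -> Fn n s @[n --> \oo] --> F s) ->
  sewn H f A G F.
Proof.
move=> sFn AnA GnG FnF a b a_ge0 ab bT.
have aT : 0 <= a <= T by rewrite a_ge0 (le_trans ab).
have bT' : 0 <= b <= T by rewrite (le_trans a_ge0).
apply: (@ler_cvg_to _ \oo _ R
  (fun n => `|Fn n b - Fn n a - f a * (An n b - An n a)|)
  (fun n => H * (b - a) `^ alpha * (Gn n b - Gn n a))).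
- apply: cvg_norm; apply: cvgB.
    by apply: cvgB; exact: FnF.
  apply: cvgM; first exact: cvg_cst.
  by apply: cvgB; exact: AnA.
- apply: cvgM; first exact: cvg_cst.
  by apply: cvgB; exact: GnG.
- by near=> n; exact: sFn.
Unshelve. all: by end_near. Qed.

Lemma dominated_lim (An Gn : nat -> R -> R) A G :
  (forall n, dominated (An n) (Gn n)) ->
  (forall s, 0 <= s <= T -> An n s @[n --> \oo] --> A s) ->
  (forall s, 0 <= s <= T -> Gn n s @[n --> \oo] --> G s) ->
  dominated A G.
Proof.
move=> AGn AnA GnG a b a_ge0 ab bT.
have aT : 0 <= a <= T by rewrite a_ge0 (le_trans ab).
have bT' : 0 <= b <= T by rewrite (le_trans a_ge0).
apply: (@ler_cvg_to _ \oo _ R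
  (fun n => `|An n b - An n a|) (fun n => Gn n b - Gn n a)).
- by apply: cvg_norm; apply: cvgB; exact: AnA.
- by apply: cvgB; exact: GnG.
- by near=> n; exact: AGn.
Unshelve. all: by end_near. Qed.

Lemma sewn_sub H f A1 A2 G1 G2 F1 F2 : sewn H f A1 G1 F1 -> sewn H f A2 G2 F2 ->
  sewn H f (fun t => A1 t - A2 t) (fun t => G1 t + G2 t) (fun t => F1 t - F2 t).
Proof.
move=> s1 s2 a b a_ge0 ab bT.
have := lerD (s1 _ _ a_ge0 ab bT) (s2 _ _ a_ge0 ab bT).
rewrite -mulrDr => s12.
have -> : G1 b + G2 b - (G1 a + G2 a) = G1 b - G1 a + (G2 b - G2 a) by ring.
apply: le_trans s12; apply: le_trans (ler_normB _ _).
by rewrite le_eqVlt; apply/orP; left; apply/eqP; congr `|_|; ring.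
Qed.

(** Summation by parts moves the increments onto the Holder function f, so that
    only the size of D enters, not its variation. *)
Lemma grid_sum_by_parts f D t m : (0 < m)%N ->
  \sum_(j < m) f (grid t m j) * (D (grid t m j.+1) - D (grid t m j)) =
  f t * D t - f 0 * D 0 -
  \sum_(j < m) (f (grid t m j.+1) - f (grid t m j)) * D (grid t m j.+1).
Proof.
move=> m_gt0; rewrite -(sum_grid_steps t (fun s => f s * D s) m_gt0) -sumrB.
by apply: eq_bigr => j _; ring.
Qed.

(** The step t / m is chosen of order eta = sup |D|: the sewing error is then of
    order eta^alpha, and the m terms left by summation by parts, each of order
    eta^alpha eta, have a sum of order m eta eta^alpha <= (T + eta) eta^alpha. *)
Lemma sewn_le_sup H M f D G F t eta : 0 <= H -> holder_bound H f ->
  (forall s, 0 <= s <= T -> `|f s| <= M) ->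
  sewn H f D G F -> F 0 = 0 -> D 0 = 0 -> G 0 <= G t ->
  0 <= t <= T -> 0 < eta -> (forall s, 0 <= s <= t -> `|D s| <= eta) ->
  `|F t| <= eta `^ alpha * (H * (G t - G 0) + H * (T + eta)) + M * eta.
Proof.
move=> H_ge0 fH fM sF F0 D0 G0t tT eta_gt0 Deta; have /andP[t_ge0 t_le] := tT.
pose m := (Num.trunc (t / eta)).+1.
have m_gt0 : (0 < m)%N by [].
have te_ge0 : 0 <= t / eta by rewrite divr_ge0// ltW.
have tm : t / m%:R <= eta.
  by rewrite ler_pdivrMr ?ltr0n// mulrC -ler_pdivrMr//; exact/ltW/truncnS_gt.
have m_le : m%:R * eta <= T + eta.
  rewrite -natr1 mulrDl mul1r lerD2r (le_trans _ t_le)// -ler_pdivlMr//.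
  by rewrite truncn_le.
have tm_powR : (t / m%:R) `^ alpha <= eta `^ alpha.
  by rewrite ge0_ler_powR ?nnegrE ?(ltW alpha_gt0) ?(ltW eta_gt0) ?divr_ge0.
have := sewn_grid_sum sF tT m_gt0; rewrite F0 subr0 grid_sum_by_parts//.
rewrite D0 mulr0 subr0.
set S := \sum_(j < m) _ => FS.
have {}FS : `|F t - (f t * D t - S)| <= eta `^ alpha * (H * (G t - G 0)).
  apply: le_trans FS _; rewrite mulrA [eta `^ _ * H]mulrC ler_wpM2r ?subr_ge0//.
  by rewrite ler_wpM2l.
have SH : `|S| <= eta `^ alpha * (H * (T + eta)).
  apply: (@le_trans _ _ (\sum_(j < m) eta `^ alpha * (H * eta))); last first.
    rewrite sumr_const card_ord -mulr_natl.
    rewrite (_ : _ * _ = eta `^ alpha * H * (m%:R * eta)); last by ring.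
    by rewrite mulrA ler_wpM2l// mulr_ge0// powR_ge0.
  apply: le_trans (ler_norm_sum _ _ _) _; apply: ler_sum => j _.
  have /andP[a_ge0 _] := grid_bounds t_ge0 (ltnW (ltn_ord j)).
  have /andP[b_ge0 bt] := grid_bounds t_ge0 (ltn_ord j).
  rewrite normrM mulrA ler_pM//; last by rewrite Deta// b_ge0.
  apply: le_trans (fH _ _ a_ge0 (grid_leS _ _ t_ge0) (le_trans bt t_le)) _.
  by rewrite grid_step mulrC ler_wpM2r.
have fD : `|f t * D t| <= M * eta.
  by rewrite normrM ler_pM ?fM ?Deta// t_ge0/=.
have -> : F t = F t - (f t * D t - S) + (f t * D t - S) by rewrite subrK.
apply: le_trans (ler_normD _ _) _; rewrite mulrDr -addrA lerD//.
by apply: le_trans (ler_normB _ _) _; rewrite addrC lerD.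
Qed.

End Sewing.

(** * Integrals against step functions *)

Section JumpSums.
Variables (R : realType) (N : nat) (p : nat -> R).
Implicit Types (w v f : nat -> R) (a b t : R).

Definition jump_sum w t : R := \sum_(i < N | p i <= t) w i.

Lemma jump_sumB w a b : a <= b ->
  jump_sum w b - jump_sum w a = \sum_(i < N | a < p i <= b) w i.
Proof.
move=> ab; rewrite /jump_sum (big_mkcond (fun i : 'I_N => p i <= b)).
rewrite (big_mkcond (fun i : 'I_N => p i <= a)).
rewrite (big_mkcond (fun i : 'I_N => a < p i <= b)) -sumrB.
apply: eq_bigr => i _; have [pa|pa] := leP (p i) a.
  by rewrite (le_trans pa ab) subrr.
by case: ifP; rewrite subr0.
Qed.

Lemma jump_sum0 w : (forall i, (i < N)%N -> 0 < p i) -> jump_sum w 0 = 0.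
Proof.
by move=> p_gt0; rewrite /jump_sum big_pred0// => i; rewrite leNgt p_gt0.
Qed.

Lemma dominated_jump_sum T w v : (forall i, (i < N)%N -> `|w i| <= v i) ->
  dominated T (jump_sum w) (jump_sum v).
Proof.
move=> wv a b a_ge0 ab bT; rewrite !jump_sumB//.
by apply: le_trans (ler_norm_sum _ _ _) _; apply: ler_sum => i _; exact: wv.
Qed.

(** Since f is evaluated at the position of each jump, the difference is the sum
    of (f (p i) - f a) w i over the jumps in ]a, b], without boundary terms. *)
Lemma sewn_jump_sum T alpha H (f : R -> R) w v :
  0 <= H -> 0 <= alpha -> holder_bound T alpha H f ->
  (forall i, (i < N)%N -> `|w i| <= v i) ->
  sewn T alpha H f (jump_sum w) (jump_sum v)
                   (jump_sum (fun i => f (p i) * w i)).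
Proof.
move=> H_ge0 alpha_ge0 fH wv a b a_ge0 ab bT; rewrite !jump_sumB//.
rewrite mulr_sumr -sumrB mulr_sumr.
apply: le_trans (ler_norm_sum _ _ _) _; apply: ler_sum => i /andP[ap pb].
rewrite -mulrBl normrM ler_pM// ?wv//.
apply: le_trans (fH _ _ a_ge0 (ltW ap) (le_trans pb bT)) _.
rewrite ler_wpM2l// ge0_ler_powR// ?nnegrE ?subr_ge0 ?(ltW ap)//.
by rewrite lerB.
Qed.

End JumpSums.

(** * Bounds given by the Holder norms *)

Section HolderBounds.
Variables (R : realType) (V : normedModType R) (T alpha : R).
Hypotheses (T_ge0 : 0 <= T) (alpha_gt0 : 0 < alpha).
Implicit Types (f : R -> V) (g : R -> R -> V).

Lemma sup_ge0 (E : set R) : (forall x, E x -> 0 <= x) -> 0 <= sup E.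
Proof.
move=> E_ge0; have [[x Ex]|E0] := pselect (E !=set0); last first.
  rewrite sup_out// => -[]//.
have [uE|nE] := pselect (has_ubound E); last by rewrite sup_out// => -[].
by rewrite (le_trans (E_ge0 _ Ex))// ub_le_sup.
Qed.

Lemma le_sup_norm t f s : has_ubound [set `|f u| | u in [set u | 0 <= u <= t]] ->
  0 <= s <= t -> `|f s| <= sup_norm t f.
Proof.
move=> uf st; apply: ub_le_sup; last by exists s.
by case: uf => B Bub; exists B => _ [u ut ->]; apply: Bub; exists u.
Qed.

Lemma sup_norm_ge0 t f : 0 <= sup_norm t f.
Proof. by apply: sup_ge0 => _ [u _ ->]. Qed.

Lemma sup_norm_le t f B : 0 <= t -> (forall s, 0 <= s <= t -> `|f s| <= B) ->
  sup_norm t f <= B.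
Proof.
move=> t_ge0 fB; apply: ge_sup; first by exists `|f 0|, 0; rewrite ?lexx.
by move=> _ [s st ->]; exact: fB.
Qed.

Lemma holder_seminorm_ge0 f : 0 <= holder_seminorm T alpha f.
Proof.
by apply: sup_ge0 => _ [s [t [_ _ _ ->]]]; rewrite divr_ge0// powR_ge0.
Qed.

Lemma holder2_seminorm_ge0 g : 0 <= holder2_seminorm T alpha g.
Proof.
by apply: sup_ge0 => _ [s [t [_ _ _ ->]]]; rewrite divr_ge0// powR_ge0.
Qed.

Lemma holder_norm_ge0 f : 0 <= holder_norm T alpha f.
Proof. by rewrite addr_ge0// ?sup_norm_ge0 ?holder_seminorm_ge0. Qed.

Lemma holder_le_seminorm f s t : holder T alpha f ->
  0 <= s -> s <= t -> t <= T ->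
  `|f t - f s| <= holder_seminorm T alpha f * (t - s) `^ alpha.
Proof.
move=> fH s_ge0; rewrite le_eqVlt => /predU1P[<- _|st tT].
  by rewrite !subrr normr0 mulr_ge0 ?holder_seminorm_ge0 ?powR_ge0.
have ts : 0 < t - s by rewrite subr_gt0.
rewrite -ler_pdivrMr ?powR_gt0//; apply: ub_le_sup => //.
exists s, t; split; rewrite ?s_ge0 ?(le_trans (ltW st))//=.
- by rewrite (le_trans s_ge0 (ltW st)).
- by rewrite lt_eqF.
- by rewrite (gtr0_norm ts).
Qed.

Lemma holder2_le_seminorm g s t : holder2 T alpha g ->
  0 <= s -> s < t -> t <= T ->
  `|g s t| <= holder2_seminorm T alpha g * (t - s) `^ alpha.
Proof.
move=> gH s_ge0 st tT; have ts : 0 < t - s by rewrite subr_gt0.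
rewrite -ler_pdivrMr ?powR_gt0//; apply: ub_le_sup => //.
by exists s, t; split; rewrite ?(gtr0_norm ts).
Qed.

Lemma holder_le_norm f s t : holder T alpha f ->
  0 <= s -> s <= t -> t <= T ->
  `|f t - f s| <= holder_norm T alpha f * (t - s) `^ alpha.
Proof.
move=> fH s_ge0 st tT; apply: le_trans (holder_le_seminorm fH s_ge0 st tT) _.
by rewrite ler_wpM2r ?powR_ge0// lerDr sup_norm_ge0.
Qed.

Lemma holder_sup_le_norm f s : holder T alpha f -> 0 <= s <= T ->
  `|f s| <= holder_norm T alpha f.
Proof.
move=> fH sT; apply: (@le_trans _ _ (sup_norm T f)); last first.
  by rewrite lerDl holder_seminorm_ge0.
apply: le_sup_norm => //.
exists (`|f 0| + holder_seminorm T alpha f * T `^ alpha) => _ [u /andP[u0 uT] <-].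
rewrite -[f u](subrK (f 0)) addrC (le_trans (ler_normD _ _))// lerD2l.
apply: le_trans (holder_le_seminorm fH (lexx 0) u0 uT) _.
by rewrite subr0 ler_wpM2l ?holder_seminorm_ge0// ge0_ler_powR// ltW.
Qed.

End HolderBounds.

Lemma le_mx_norm (R : realType) m n (A : 'M[R]_(m, n)) i j : `|A i j| <= `|A|.
Proof.
rewrite [leRHS]mx_normrE; exact: (le_bigmax _ (fun ij => `|A ij.1 ij.2|) (i, j)).
Qed.

(** * Squared increments of a controlled path *)

Lemma sum_ord_le (R : realType) n (F : 'I_n -> R) c : (forall i, F i <= c) ->
  \sum_(i < n) F i <= n%:R * c.
Proof.
move=> Fc; apply: (@le_trans _ _ (\sum_(i < n) c)); first exact: ler_sum.
by rewrite sumr_const card_ord mulr_natl.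
Qed.

(** The elementary inequality 2 |x k * x l| <= (x k)^2 + (x l)^2 is what makes the
    sum of the variations of the coordinates control every covariation. *)
Lemma normr_mul_le_sum_sqr (R : realType) n (x : 'I_n -> R) k l :
  `|x k * x l| <= \sum_(i < n) x i * x i.
Proof.
have xx i : 0 <= x i * x i by rewrite -expr2 sqr_ge0.
have le_sum i : x i * x i <= \sum_(i < n) x i * x i.
  by rewrite (bigD1 i)//= lerDl sumr_ge0.
have := le_sum k; have := le_sum l; set S := \sum_(i < n) _.
rewrite ler_norml; have : 0 <= (x k + x l) ^+ 2 by exact: sqr_ge0.
have : 0 <= (x k - x l) ^+ 2 by exact: sqr_ge0.
move=> *; apply/andP; split; nra.
Qed.

Definition increment_bound (R : realType) (T alpha : R) (K : nat)
    (Z Y S : R) : R :=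
  S * (2 * (K%:R * Y * Z) + S * T `^ alpha) + K%:R * K%:R * (2 * Y * Y * Z * Z).

Section ControlledIncrements.
Variables (R : realType) (T alpha : R) (K : nat).
Hypotheses (T_ge0 : 0 <= T) (alpha_gt0 : 0 < alpha).
Variables (z y' : 'I_K -> R -> R) (y : R -> R) (Z Y S : R).
Hypotheses (Z_ge0 : 0 <= Z) (Y_ge0 : 0 <= Y) (S_ge0 : 0 <= S).
Hypothesis z_holder : forall k, holder_bound T alpha Z (z k).
Hypothesis y'_holder : forall k, holder_bound T alpha Y (y' k).
Hypothesis y'_bounded : forall k s, 0 <= s <= T -> `|y' k s| <= Y.
Hypothesis y_controlled : forall s t, 0 <= s -> s < t -> t <= T ->
  `|y t - y s - \sum_(k < K) y' k s * (z k t - z k s)|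
    <= S * (t - s) `^ (2 * alpha).

Lemma holder_boundM k l : holder_bound T alpha (2 * Y * Y)
  (fun r => y' k r * y' l r).
Proof.
move=> s t s_ge0 st tT.
have -> : y' k t * y' l t - y' k s * y' l s =
  (y' k t - y' k s) * y' l t + y' k s * (y' l t - y' l s) by ring.
apply: le_trans (ler_normD _ _) _; rewrite !normrM.
have -> : 2 * Y * Y * (t - s) `^ alpha =
  Y * (t - s) `^ alpha * Y + Y * (Y * (t - s) `^ alpha) by ring.
rewrite lerD// ler_pM//; do ?exact: y'_holder.
- by rewrite y'_bounded// tT (le_trans s_ge0).
- by rewrite y'_bounded// s_ge0 (le_trans st).
Qed.

(** With u = y' . dz and r the remainder, (dy)^2 - u^2 = r (2 u + r) is a product
    of terms of order (t - s)^(2 alpha) and (t - s)^alpha. Passing from s to t in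
    y' k * y' l changes the coefficients of dz^k dz^l by a term of order
    (t - s)^alpha, again against (t - s)^(2 alpha). *)
Lemma controlled_sqr_increment s t : 0 <= s -> s < t -> t <= T ->
  `|(y t - y s) * (y t - y s) - \sum_(k < K) \sum_(l < K)
      (y' k t * y' l t) * ((z k t - z k s) * (z l t - z l s))|
    <= increment_bound T alpha K Z Y S * (t - s) `^ (3 * alpha).
Proof.
move=> s_ge0 st tT.
have ts_ge0 : 0 <= t - s by rewrite subr_ge0 ltW.
pose q := (t - s) `^ alpha.
have q_ge0 : 0 <= q by exact: powR_ge0.
have qn n : (t - s) `^ (n%:R * alpha) = q ^+ n.
  by rewrite mulrC powRrM powR_mulrn.
have qT : q <= T `^ alpha.
  rewrite ge0_ler_powR ?nnegrE ?(ltW alpha_gt0)//.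
  by rewrite lerBlDr (le_trans tT)// lerDl.
have zq k : `|z k t - z k s| <= Z * q by apply: z_holder => //; exact: ltW.
have sT : 0 <= s <= T by rewrite s_ge0 (le_trans (ltW st)).
pose u := \sum_(k < K) y' k s * (z k t - z k s).
pose r := y t - y s - u.
have uq : `|u| <= K%:R * Y * Z * q.
  apply: le_trans (ler_norm_sum _ _ _) _; rewrite -!mulrA; apply: sum_ord_le => k.
  by rewrite normrM ler_pM// y'_bounded.
have rq : `|r| <= S * q ^+ 2 by rewrite -qn; exact: y_controlled.
rewrite qn.
have -> : (y t - y s) * (y t - y s) - \sum_(k < K) \sum_(l < K)
      (y' k t * y' l t) * ((z k t - z k s) * (z l t - z l s)) =
  r * (u + u + r) - \sum_(k < K) \sum_(l < K)
    (y' k t * y' l t - y' k s * y' l s) * ((z k t - z k s) * (z l t - z l s)).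
  have -> : y t - y s = u + r by rewrite /r [RHS]addrC subrK.
  have uu : u * u = \sum_(k < K) \sum_(l < K)
      (y' k s * y' l s) * ((z k t - z k s) * (z l t - z l s)).
    rewrite /u big_distrlr/=; apply: eq_bigr => k _; apply: eq_bigr => l _; ring.
  have -> : (u + r) * (u + r) = r * (u + u + r) + u * u by ring.
  rewrite -addrA; congr (_ + _); rewrite uu -!sumrB -sumrN.
  apply: eq_bigr => k _; rewrite -sumrB -sumrN.
  by apply: eq_bigr => l _; ring.
apply: le_trans (ler_normB _ _) _; rewrite [leRHS]mulrDl; apply: lerD.
  rewrite normrM.
  apply: (@le_trans _ _ (S * q ^+ 2 *
      (K%:R * Y * Z * q + K%:R * Y * Z * q + S * q ^+ 2))).
    rewrite ler_pM//; apply: le_trans (ler_normD _ _) _; apply: lerD => //.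
    by apply: le_trans (ler_normD _ _) _; exact: lerD.
  have -> : S * q ^+ 2 * (K%:R * Y * Z * q + K%:R * Y * Z * q + S * q ^+ 2) =
    S * (2 * (K%:R * Y * Z) + S * q) * q ^+ 3 by ring.
  by rewrite ler_wpM2r ?exprn_ge0// ler_wpM2l// lerD2l ler_wpM2l.
apply: le_trans (ler_norm_sum _ _ _) _; rewrite -!mulrA; apply: sum_ord_le => k.
apply: le_trans (ler_norm_sum _ _ _) _; apply: sum_ord_le => l.
rewrite !normrM.
have -> : 2 * (Y * (Y * (Z * (Z * q ^+ 3)))) =
  2 * Y * Y * q * (Z * q * (Z * q)) by ring.
rewrite ler_pM ?mulr_ge0//; first by apply: holder_boundM => //; exact: ltW.
by rewrite ler_pM.
Qed.

End ControlledIncrements.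

(** * Rate of convergence of sewn functions *)

Section Rate.
Variables (R : realType) (T alpha : R).
Hypotheses (T_ge0 : 0 <= T) (alpha_gt0 : 0 < alpha) (alpha_le1 : alpha <= 1).

Definition rate_constant (H M B : R) : R :=
  H * B + H * (T + B) + M * B `^ (1 - alpha).

Lemma rate_constant_ge0 H M B : 0 <= H -> 0 <= M -> 0 <= B ->
  0 <= rate_constant H M B.
Proof.
by move=> *; rewrite !addr_ge0// mulr_ge0 ?powR_ge0 ?addr_ge0.
Qed.

(** This serves for a vanishing supremum, where the grid of step of order eta in
    [sewn_le_sup] is not available and eta is replaced by arbitrarily small
    positive numbers. *)
Lemma le0_powR_small (x c B : R) : 0 <= c -> 0 < B ->
  (forall eta, 0 < eta -> eta <= B -> x <= c * eta `^ alpha) -> x <= 0.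
Proof.
move=> c_ge0 B_gt0 xc; apply/ler_addgt0Pr => e e_gt0; rewrite add0r.
have c1_gt0 : 0 < c + 1 by rewrite ltr_wpDl.
have [d d_gt0 dP] := powR_small alpha_gt0 (divr_gt0 e_gt0 c1_gt0).
have m_gt0 : 0 < Num.min B d by rewrite lt_min B_gt0.
apply: le_trans (xc _ m_gt0 _) _; first by rewrite ge_min lexx.
apply: (@le_trans _ _ (c * (e / (c + 1)))).
  by rewrite ler_wpM2l// dP ?(ltW m_gt0)// ge_min lexx orbT.
rewrite mulrA ler_pdivrMr// mulrC ler_wpM2l ?(ltW e_gt0)//; lra.
Qed.

(** The loss of eps in the exponent is paid by the factor B^eps. As alpha - eps may
    be negative, the case eta = 0 is treated apart, by 0^alpha = 0. *)
Lemma le_powR_shift (eta B eps : R) : 0 <= eta -> eta <= B -> 0 < eps ->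
  eta `^ alpha <= B `^ eps * eta `^ (alpha - eps).
Proof.
rewrite le_eqVlt => /predU1P[<-|eta_gt0] etaB eps_gt0.
  by rewrite powR0 ?gt_eqF// mulr_ge0// powR_ge0.
have -> : eta `^ alpha = eta `^ eps * eta `^ (alpha - eps).
  by rewrite -powRD 1?addrC ?subrK// (gt_eqF eta_gt0) implybT.
rewrite ler_wpM2r ?powR_ge0// ge0_ler_powR ?nnegrE ?(ltW eta_gt0) ?(ltW eps_gt0)//.
exact: ltW (lt_le_trans eta_gt0 etaB).
Qed.

(** The difference F1 - F2 is sewn from f d(A1 - A2) with control G1 + G2, so
    [sewn_le_sup] applies to it. The term M * eta is absorbed using
    eta = eta^(1 - alpha) eta^alpha <= B^(1 - alpha) eta^alpha. *)
Lemma sewn_rate H M B (f A1 A2 G1 G2 F1 F2 : R -> R) t :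
  0 <= H -> 0 <= M -> holder_bound T alpha H f ->
  (forall s, 0 <= s <= T -> `|f s| <= M) ->
  dominated T A1 G1 -> dominated T A2 G2 ->
  sewn T alpha H f A1 G1 F1 -> sewn T alpha H f A2 G2 F2 ->
  A1 0 = 0 -> A2 0 = 0 -> G1 0 = 0 -> G2 0 = 0 -> F1 0 = 0 -> F2 0 = 0 ->
  0 < B -> G1 T + G2 T <= B -> 0 <= t <= T ->
  let eta := sup_norm t (A1 \- A2) in
  [/\ 0 <= eta, eta <= B &
      `|F1 t - F2 t| <= rate_constant H M B * eta `^ alpha].
Proof.
move=> H_ge0 M_ge0 fH fM AG1 AG2 s1 s2 A10 A20 G10 G20 F10 F20 B_gt0 GB tT eta.
have /andP[t_ge0 t_le] := tT.
pose G s := G1 s + G2 s.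
have G0 : G 0 = 0 by rewrite /G G10 G20 addr0.
have G_mono a b : 0 <= a -> a <= b -> b <= T -> G a <= G b.
  by move=> *; rewrite lerD ?(dominated_mono AG1) ?(dominated_mono AG2).
have DB s : 0 <= s <= t -> `|(A1 \- A2) s| <= B.
  move=> /andP[s_ge0 st]; have sT := le_trans st t_le.
  apply: le_trans GB; apply: le_trans (G_mono _ _ s_ge0 sT (lexx T)).
  apply: le_trans (ler_normB _ _) _; apply: lerD.
    by have := AG1 _ _ (lexx 0) s_ge0 sT; rewrite A10 G10 !subr0.
  by have := AG2 _ _ (lexx 0) s_ge0 sT; rewrite A20 G20 !subr0.
have eta_ge0 : 0 <= eta by exact: sup_norm_ge0.
have etaB : eta <= B by exact: sup_norm_le.
have Deta s : 0 <= s <= t -> `|(A1 \- A2) s| <= eta.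
  by move=> st; apply: le_sup_norm => //; exists B => _ [u ut <-]; exact: DB.
have key x : 0 < x -> x <= B -> eta <= x ->
    `|F1 t - F2 t| <= rate_constant H M B * x `^ alpha.
  move=> x_gt0 xB etax.
  have := @sewn_le_sup _ _ _ alpha_gt0 H M f (A1 \- A2) G
    (fun s => F1 s - F2 s) t x H_ge0 fH fM (sewn_sub s1 s2).
  rewrite F10 F20 subrr /= A10 A20 subrr G0 subr0.
  move=> /(_ erefl erefl); rewrite -{1}G0 => /(_ (G_mono _ _ (lexx _) t_ge0 t_le)).
  move=> /(_ tT x_gt0 (fun s st => le_trans (Deta s st) etax)) /le_trans; apply.
  rewrite /rate_constant [leRHS]mulrDl [leRHS]addrC [leRHS]addrC mulrC.
  apply: lerD.
    rewrite ler_wpM2r ?powR_ge0// lerD// ler_wpM2l//.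
      by apply: le_trans GB; exact: G_mono.
    by rewrite lerD2l.
  rewrite -mulrA ler_wpM2l// -{1}(powRr1 (ltW x_gt0)) -{1}(subrK alpha 1).
  rewrite powRD; last by rewrite (gt_eqF x_gt0) implybT.
  rewrite ler_wpM2r ?powR_ge0// ge0_ler_powR ?nnegrE ?subr_ge0//; exact: ltW.
split => //; move: eta_ge0; rewrite le_eqVlt => /predU1P[eta0|eta_gt0]; last first.
  exact: key.
rewrite -eta0 powR0 ?gt_eqF// mulr0.
apply: (le0_powR_small (rate_constant_ge0 H_ge0 M_ge0 (ltW B_gt0)) B_gt0).
by move=> x x_gt0 xB; apply: key => //; rewrite -eta0 ltW.
Qed.

End Rate.

(** * Regularity from domination *)

Lemma continuous_dominated (R : realType) (T C : R) (g G : R -> R) : 0 <= C ->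
  (forall a b, 0 <= a -> a <= b -> b <= T -> `|g b - g a| <= C * (G b - G a)) ->
  {within `[0, T], continuous G} -> {within `[0, T], continuous g}.
Proof.
move=> C_ge0 gG /subspace_continuousP Gc; apply/subspace_continuousP => x xT.
have C1_gt0 : 0 < C + 1 by rewrite ltr_wpDl.
apply/cvgrPdist_le => e e_gt0.
have /cvgrPdist_le/(_ _ (divr_gt0 e_gt0 C1_gt0)) := Gc x xT.
rewrite !near_withinE; apply: filterS => u Gu uT; have {}Gu := Gu uT.
suff /le_trans : `|g x - g u| <= C * `|G x - G u|.
  apply; apply: (@le_trans _ _ (C * (e / (C + 1)))); first by rewrite ler_wpM2l.
  rewrite mulrA ler_pdivrMr// mulrC ler_wpM2l ?(ltW e_gt0)//; lra.
move: xT uT; rewrite /= !in_itv/= => /andP[x0 xT] /andP[u0 uT].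
have [xu|/ltW ux] := leP x u.
  rewrite distrC [in leRHS]distrC; apply: le_trans (gG _ _ x0 xu uT) _.
  by rewrite ler_wpM2l// ler_norm.
by apply: le_trans (gG _ _ u0 ux xT) _; rewrite ler_wpM2l// ler_norm.
Qed.

Lemma bounded_variation_dominated (R : realType) (T C : R) (g G : R -> R) :
  (forall a b, 0 <= a -> a <= b -> b <= T -> `|g b - g a| <= C * (G b - G a)) ->
  bounded_variation 0 T g.
Proof.
move=> gG; exists (C * (G T - G 0)) => _ [s ps <-].
rewrite /variation -(sum_node_steps G ps) mulr_sumr big_mkord.
apply: ler_sum => i _; have si := ltn_ord i.
have nodeE j : (j <= size s)%N -> nth T (0 :: s) j = node 0 s j.
  by move=> js; apply: set_nth_default.
have [/andP[a_ge0 _] /andP[_ bT]] := (node_bounds ps (ltnW si), node_bounds ps si).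
have ab : node 0 s i <= node 0 s i.+1 by rewrite (node_le ps)// leqnSn.
have := gG _ _ a_ge0 ab bT.
by rewrite -{1}(nodeE i.+1 si) -{1}(nodeE i (ltnW si)).
Qed.

(** * Scaled variation of a controlled path *)

Section ControlledVariation.
Variables (R : realType) (T alpha gamma : R) (K : nat).
Hypotheses (T_gt0 : 0 < T) (alpha_gt0 : 0 < alpha) (alpha_le1 : alpha <= 1).
Hypothesis gamma_alpha : 1 < gamma + 3 * alpha.
Variables (Pi : nat -> seq R) (z y' : 'I_K -> R -> R) (y : R -> R) (Z Y S : R).
Hypothesis Pi_partition : forall n, itv_partition 0 T (Pi n).
Hypothesis Pi_mesh : (fun n => mesh 0 (Pi n)) @ \oo --> (0 : R).
Hypotheses (Z_ge0 : 0 <= Z) (Y_ge0 : 0 <= Y) (S_ge0 : 0 <= S).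
Hypothesis z_holder : forall k, holder_bound T alpha Z (z k).
Hypothesis y'_holder : forall k, holder_bound T alpha Y (y' k).
Hypothesis y'_bounded : forall k s, 0 <= s <= T -> `|y' k s| <= Y.
Hypothesis y_controlled : forall s t, 0 <= s -> s < t -> t <= T ->
  `|y t - y s - \sum_(k < K) y' k s * (z k t - z k s)|
    <= S * (t - s) `^ (2 * alpha).
Hypothesis z_cvg : forall k l t, 0 <= t <= T ->
  cvgn (fun n => scaled_cov_n Pi gamma (z k) (z l) n t).

Let T_ge0 : 0 <= T := ltW T_gt0.
Let A n k l := scaled_cov_n Pi gamma (z k) (z l) n.
Let A_lim k l := scaled_cov Pi gamma (z k) (z l).
Let G n t := \sum_(i < K) A n i i t.
Let G_lim t := \sum_(i < K) A_lim i i t.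
Let f k l r := y' k r * y' l r.
Let w n k l i := (node 0 (Pi n) i.+1 - node 0 (Pi n) i) `^ gamma
  * (z k (node 0 (Pi n) i.+1) - z k (node 0 (Pi n) i))
  * (z l (node 0 (Pi n) i.+1) - z l (node 0 (Pi n) i)).

(** The integral of y' k * y' l against the step function
    [scaled_cov_n Pi gamma (z k) (z l) n]. *)
Definition weighted_cov n k l : R -> R :=
  jump_sum (size (Pi n)) (fun i => node 0 (Pi n) i.+1)
    (fun i => f k l (node 0 (Pi n) i.+1) * w n k l i).

Definition weighted_cov_lim k l t : R :=
  lim ((fun n => weighted_cov n k l t) @ \oo).

Let A_cvg k l t : 0 <= t <= T -> A n k l t @[n --> \oo] --> A_lim k l t.
Proof. exact: z_cvg. Qed.

Let G_cvg t : 0 <= t <= T -> G n t @[n --> \oo] --> G_lim t.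
Proof.
move=> tT; apply: cvg_big => [|i _]; first exact: add_continuous.
exact: A_cvg.
Qed.

Let A_jump_sum n k l : A n k l = jump_sum (size (Pi n))
  (fun i => node 0 (Pi n) i.+1) (w n k l).
Proof. by []. Qed.

Let G_jump_sum n : G n = jump_sum (size (Pi n))
  (fun i => node 0 (Pi n) i.+1) (fun i => \sum_(k < K) w n k k i).
Proof. by apply/funext => t; rewrite /G exchange_big. Qed.

Let w_le n k l i : `|w n k l i| <= \sum_(j < K) w n j j i.
Proof.
rewrite /w; set h := _ `^ gamma; have h_ge0 : 0 <= h by exact: powR_ge0.
under eq_bigr do rewrite -mulrA.
rewrite -mulrA normrM (ger0_norm h_ge0) -mulr_sumr ler_wpM2l//.
exact: (normr_mul_le_sum_sqr (fun k => z k _ - z k _)).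
Qed.

Let node_pos n i : (i < size (Pi n))%N -> 0 < node 0 (Pi n) i.+1.
Proof. exact: node_gt. Qed.

Let A0 n k l : A n k l 0 = 0.
Proof. by rewrite A_jump_sum jump_sum0// => i; exact: node_pos. Qed.

Let G0 n : G n 0 = 0.
Proof. by rewrite /G big1. Qed.

Let lim_at0 (u : nat -> R -> R) (v : R) : (forall n, u n 0 = 0) ->
  u n 0 @[n --> \oo] --> v -> v = 0.
Proof.
move=> u0 uv; rewrite (_ : (fun n => u n 0) = fun=> 0) in uv.
  by rewrite -(cvg_lim (@Rhausdorff R) uv) lim_cst.
exact/funext.
Qed.

Let zero_in : 0 <= (0 : R) <= T. Proof. by rewrite lexx. Qed.

Let A_lim0 k l : A_lim k l 0 = 0.
Proof.
exact: (@lim_at0 (fun n => A n k l) _ (fun n => A0 n k l) (A_cvg zero_in)).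
Qed.

Let G_lim0 : G_lim 0 = 0.
Proof. by rewrite /G_lim big1. Qed.

Let AG n k l : dominated T (A n k l) (G n).
Proof.
rewrite G_jump_sum A_jump_sum; apply: dominated_jump_sum => i _; exact: w_le.
Qed.

Let AG_lim k l : dominated T (A_lim k l) G_lim.
Proof.
by apply: (dominated_lim (fun n => AG n k l)) => s;
  [exact: A_cvg | exact: G_cvg].
Qed.

Let H_ge0 : 0 <= 2 * Y * Y. Proof. by rewrite !mulr_ge0. Qed.

Let f_holder k l : holder_bound T alpha (2 * Y * Y) (f k l).
Proof. exact: holder_boundM. Qed.

Let f_bounded k l s : 0 <= s <= T -> `|f k l s| <= Y * Y.
Proof. by move=> sT; rewrite normrM ler_pM// y'_bounded. Qed.

Let F_sewn n k l :
  sewn T alpha (2 * Y * Y) (f k l) (A n k l) (G n) (weighted_cov n k l).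
Proof.
rewrite G_jump_sum A_jump_sum; apply: sewn_jump_sum (f_holder k l) _ => //.
exact: ltW.
Qed.

Let F0 n k l : weighted_cov n k l 0 = 0.
Proof. by rewrite /weighted_cov jump_sum0// => i; exact: node_pos. Qed.

Let F_cvg k l t : 0 <= t <= T ->
  weighted_cov n k l t @[n --> \oo] --> weighted_cov_lim k l t.
Proof.
move=> tT; apply: (sewn_cvg alpha_gt0 H_ge0 (fun n => F_sewn n k l)) tT => //.
- exact: A_cvg.
- exact: G_cvg.
Qed.

Let F_lim0 k l : weighted_cov_lim k l 0 = 0.
Proof.
exact: (@lim_at0 (fun n => weighted_cov n k l) _ (fun n => F0 n k l)
  (F_cvg zero_in)).
Qed.

Let F_lim_sewn k l :
  sewn T alpha (2 * Y * Y) (f k l) (A_lim k l) G_lim (weighted_cov_lim k l).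
Proof.
apply: (sewn_lim (fun n => F_sewn n k l)) => s.
- exact: A_cvg.
- exact: G_cvg.
- exact: F_cvg.
Qed.

Lemma weighted_cov_is_RSint k l t : 0 <= t <= T ->
  is_RSint (fun r => y' k r * y' l r) (scaled_cov Pi gamma (z k) (z l)) 0 t
    (weighted_cov_lim k l t).
Proof.
move=> tT; have := sewn_is_RSint alpha_gt0 H_ge0 (f_holder k l) (@AG_lim k l)
  (@F_lim_sewn k l) tT.
by rewrite F_lim0 subr0.
Qed.

(** [controlled_sqr_increment] weighted by h^gamma gives errors of order
    h^(gamma + 3 alpha), whose exponent exceeds 1; [sum_powR_steps] sums them. *)
Lemma scaled_var_weighted_cov n t :
  `|scaled_cov_n Pi gamma y y n t -
    \sum_(k < K) \sum_(l < K) weighted_cov n k l t|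
  <= increment_bound T alpha K Z Y S * T *
     mesh 0 (Pi n) `^ (gamma + 3 * alpha - 1).
Proof.
set C := increment_bound _ _ _ _ _ _.
have C_ge0 : 0 <= C.
  by rewrite /C /increment_bound !addr_ge0// ?mulr_ge0 ?addr_ge0 ?mulr_ge0
    ?powR_ge0.
have -> : \sum_(k < K) \sum_(l < K) weighted_cov n k l t =
  \sum_(i < size (Pi n) | node 0 (Pi n) i.+1 <= t)
    \sum_(k < K) \sum_(l < K) f k l (node 0 (Pi n) i.+1) * w n k l i.
  rewrite exchange_big/=; under [RHS]eq_bigr do rewrite exchange_big/=.
  rewrite [RHS]exchange_big/=; apply: eq_bigr => l _.
  by rewrite exchange_big.
rewrite /scaled_cov_n -sumrB; apply: le_trans (ler_norm_sum _ _ _) _.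
have ps := Pi_partition n.
have th_gt0 : 0 < gamma + 3 * alpha - 1 by rewrite subr_gt0.
have := sum_powR_steps ps th_gt0; rewrite subr0 addrCA subrr addr0.
move=> /(ler_wpM2l C_ge0); rewrite mulrA => /(le_trans _); apply.
rewrite mulr_sumr big_mkcond/=; apply: ler_sum => i _; have si := ltn_ord i.
case: ifP => _; last by rewrite mulr_ge0// powR_ge0.
set a := node 0 (Pi n) i; set b := node 0 (Pi n) i.+1.
have /andP[a_ge0 _] : 0 <= a <= T := node_bounds ps (ltnW si).
have /andP[_ bT] : 0 <= b <= T := node_bounds ps si.
have ab : a < b := node_ltS ps si.
have := controlled_sqr_increment T_ge0 alpha_gt0 S_ge0 z_holder
  y'_holder y'_bounded y_controlled a_ge0 ab bT.
move=> /(ler_wpM2l (powR_ge0 (b - a) gamma)).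
rewrite [X in _ <= X -> _]mulrCA -powRD; last first.
  by rewrite gt_eqF// (lt_trans ltr01).
apply: le_trans; rewrite -[X in _ <= X * _]ger0_norm ?powR_ge0// -normrM.
rewrite [X in _ <= `|X|]mulrBr [X in _ <= `|X - _|]mulrA.
rewrite le_eqVlt; apply/orP; left; apply/eqP.
congr (`|_ - _|); rewrite mulr_sumr; apply: eq_bigr => k _.
by rewrite mulr_sumr; apply: eq_bigr => l _; rewrite /f /w -/a -/b; ring.
Qed.

Let mesh_powR_cvg0 (theta : R) : 0 < theta ->
  mesh 0 (Pi n) `^ theta @[n --> \oo] --> (0 : R).
Proof.
move=> th_gt0; apply/cvgrPdist_le => e e_gt0.
have [d d_gt0 dP] := powR_small th_gt0 e_gt0.
have /cvgrPdist_le/(_ d d_gt0) := Pi_mesh.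
apply: filterS => n; rewrite !sub0r !normrN !ger0_norm ?powR_ge0 ?mesh_ge0//.
by move=> nd; apply: dP => //; exact: mesh_ge0.
Qed.

Lemma scaled_var_controlled_cvg t : 0 <= t <= T ->
  scaled_cov_n Pi gamma y y n t @[n --> \oo] -->
  \sum_(k < K) \sum_(l < K) weighted_cov_lim k l t.
Proof.
move=> tT.
have sum_cvg : \sum_(k < K) \sum_(l < K) weighted_cov n k l t @[n --> \oo] -->
    \sum_(k < K) \sum_(l < K) weighted_cov_lim k l t.
  apply: cvg_big => [|k _]; first exact: add_continuous.
  apply: cvg_big => [|l _]; first exact: add_continuous.
  exact: F_cvg.
rewrite -[X in _ --> X]add0r.
rewrite [X in X @ _ --> _](_ : _ = fun n => (scaled_cov_n Pi gamma y y n t -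
    \sum_(k < K) \sum_(l < K) weighted_cov n k l t) +
    \sum_(k < K) \sum_(l < K) weighted_cov n k l t); last first.
  by apply/funext => n; rewrite subrK.
apply: cvgD sum_cvg; apply/norm_cvg0P.
have th_gt0 : 0 < gamma + 3 * alpha - 1 by rewrite subr_gt0.
apply: (@squeeze_cvgr _ _ _ _ (fun=> 0) (fun n =>
  increment_bound T alpha K Z Y S * T * mesh 0 (Pi n) `^ (gamma + 3 * alpha - 1))).
- by near=> n; rewrite normr_ge0 scaled_var_weighted_cov.
- exact: cvg_cst.
- by rewrite -[X in _ --> X](mulr0 (increment_bound T alpha K Z Y S * T));
    apply: cvgM; [exact: cvg_cst | exact: mesh_powR_cvg0].
Unshelve. all: by end_near. Qed.

Lemma scaled_cov_controlled t : 0 <= t <= T ->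
  scaled_cov Pi gamma y y t = \sum_(k < K) \sum_(l < K) weighted_cov_lim k l t.
Proof. by move=> tT; apply: cvg_lim => //; exact: scaled_var_controlled_cvg. Qed.

Let F_lim_dominated k l a b : 0 <= a -> a <= b -> b <= T ->
  `|weighted_cov_lim k l b - weighted_cov_lim k l a| <=
    (2 * Y * Y * T `^ alpha + Y * Y) * (G_lim b - G_lim a).
Proof.
move=> a_ge0 ab bT.
have dA := AG_lim k l a_ge0 ab bT.
have dG_ge0 : 0 <= G_lim b - G_lim a := le_trans (normr_ge0 _) dA.
rewrite -[X in `|X|](subrK (f k l a * (A_lim k l b - A_lim k l a))).
rewrite mulrDl; apply: le_trans (ler_normD _ _) _; apply: lerD.
  apply: le_trans (F_lim_sewn k l a_ge0 ab bT) _.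
  rewrite ler_wpM2r// ler_wpM2l// ge0_ler_powR ?nnegrE ?subr_ge0 ?(ltW alpha_gt0)//.
  by rewrite lerBlDr (le_trans bT)// lerDl.
by rewrite normrM ler_pM// f_bounded// a_ge0 (le_trans ab).
Qed.

(** The limit inherits domination by the total scaled variation of z, hence its
    continuity and its bounded variation. *)
Lemma scaled_cov_controlled_dominated a b : 0 <= a -> a <= b -> b <= T ->
  `|scaled_cov Pi gamma y y b - scaled_cov Pi gamma y y a| <=
    K%:R * (K%:R * (2 * Y * Y * T `^ alpha + Y * Y)) *
    (\sum_(i < K) scaled_cov Pi gamma (z i) (z i) b -
     \sum_(i < K) scaled_cov Pi gamma (z i) (z i) a).
Proof.
move=> a_ge0 ab bT; rewrite !scaled_cov_controlled.
- rewrite -sumrB; apply: le_trans (ler_norm_sum _ _ _) _.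
  rewrite -[leRHS]mulrA; apply: sum_ord_le => k.
  rewrite -sumrB; apply: le_trans (ler_norm_sum _ _ _) _.
  by rewrite -[leRHS]mulrA; apply: sum_ord_le => l; exact: F_lim_dominated.
- by rewrite a_ge0 (le_trans ab).
- by rewrite (le_trans a_ge0).
Qed.

(** The total scaled variation of z at T along pi_n exceeds its limit V by at
    most 1 for large n; B = 2 V + 1 then bounds both the sum of the two controls
    and the supremum of the difference of the covariations. *)
Lemma scaled_var_rate t eps : 0 <= t <= T -> 0 < eps ->
  let V := \sum_(i < K) scaled_cov Pi gamma (z i) (z i) T in
  let B := 2 * V + 1 in
  \forall n \near \oo,
    `|scaled_cov_n Pi gamma y y n t -
      \sum_(k < K) \sum_(l < K) weighted_cov_lim k l t| <=
    (increment_bound T alpha K Z Y S * T +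
     K%:R * (K%:R * (rate_constant T alpha (2 * Y * Y) (Y * Y) B * B `^ eps))) *
    (mesh 0 (Pi n) `^ (gamma + 3 * alpha - 1) +
     \big[Num.max/0]_(k < K) \big[Num.max/0]_(l < K)
       sup_norm t (scaled_cov_n Pi gamma (z k) (z l) n \-
                   scaled_cov Pi gamma (z k) (z l)) `^ (alpha - eps)).
Proof.
move=> tT eps_gt0 V B.
have TT : 0 <= T <= T by rewrite T_ge0 lexx.
have V_ge0 : 0 <= V.
  rewrite /V; case: (pickP (fun _ : 'I_K => true)) => [k _|noK].
    have := le_trans (normr_ge0 _) (AG_lim k k (lexx _) T_ge0 (lexx T)).
    by rewrite G_lim0 subr0.
  by rewrite big1// => i; have := noK i.
have B_gt0 : 0 < B by rewrite ltr_wpDl// mulr_ge0.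
near=> n.
have GnT : G n T + G_lim T <= B.
  have : `|G_lim T - G n T| <= 1.
    by near: n; have /cvgrPdist_le/(_ 1 ltr01) := G_cvg TT.
  rewrite distrC => /(le_trans (ler_norm _)).
  rewrite -/(G_lim T) in V B V_ge0 B_gt0 *.
  by rewrite /B /V; lra.
set m := \big[Num.max/0]_(k < K) _.
set IB := increment_bound _ _ _ _ _ _ * T; set rc := rate_constant _ _ _ _ _.
have IB_ge0 : 0 <= IB.
  by rewrite /IB /increment_bound mulr_ge0// !addr_ge0// ?mulr_ge0 ?addr_ge0
    ?mulr_ge0 ?powR_ge0.
have rc_ge0 : 0 <= rc by rewrite rate_constant_ge0// ?mulr_ge0// ltW.
have FF k l : `|weighted_cov n k l t - weighted_cov_lim k l t| <=
    rc * B `^ eps * m.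
  have [eta_ge0 etaB] := sewn_rate T_ge0 alpha_gt0 alpha_le1 H_ge0
    (mulr_ge0 Y_ge0 Y_ge0) (f_holder k l) (f_bounded k l) (AG n k l)
    (AG_lim k l) (F_sewn n k l) (F_lim_sewn k l) (A0 n k l) (A_lim0 k l)
    (G0 n) G_lim0 (F0 n k l) (F_lim0 k l) B_gt0 GnT tT.
  move=> /le_trans; apply; rewrite -/rc -[leRHS]mulrA ler_wpM2l//.
  apply: le_trans (le_powR_shift alpha_gt0 eta_ge0 etaB eps_gt0) _.
  rewrite ler_wpM2l ?powR_ge0//.
  apply: le_trans (le_bigmax 0 (fun k => \big[Num.max/0]_(l < K) _) k).
  exact: (le_bigmax 0 (fun l => sup_norm t _ `^ (alpha - eps)) l).
have m_ge0 : 0 <= m.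
  by rewrite /m; elim/big_rec: _ => // k x _ x_ge0; rewrite le_max x_ge0 orbT.
rewrite -[X in `|X|](subrKA (\sum_(k < K) \sum_(l < K) weighted_cov n k l t)).
apply: le_trans (ler_normD _ _) _.
apply: (@le_trans _ _ (IB * mesh 0 (Pi n) `^ (gamma + 3 * alpha - 1) +
   K%:R * (K%:R * (rc * B `^ eps)) * m)).
  apply: lerD; first exact: scaled_var_weighted_cov.
  rewrite -sumrB; apply: le_trans (ler_norm_sum _ _ _) _.
  rewrite -!mulrA; apply: sum_ord_le => k.
  rewrite -sumrB; apply: le_trans (ler_norm_sum _ _ _) _.
  by apply: sum_ord_le => l; rewrite mulrA.
rewrite mulrDr lerD//.
  by rewrite ler_wpM2r ?powR_ge0// lerDl !mulr_ge0 ?powR_ge0.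
by rewrite ler_wpM2r// lerDr.
Unshelve. all: by end_near. Qed.

End ControlledVariation.

(** * The theorem *)

Theorem theorem3p6 (R : realType) (T alpha gamma : R) (K : nat)
    (T_gt0 : 0 < T) (K_gt0 : (0 < K)%N)
    (alpha_gt : 1 / 3 < alpha) (alpha_le : alpha <= 1)
    (gamma_gt0 : 0 < gamma) (gamma_alpha : 1 < gamma + 3 * alpha) :
  (* the arguments of C are epsilon, the Holder norm of z, the total scaled
     variation of z at T, the Holder norm of y' and the Holder seminorm of the
     remainder *)
  exists C : R -> R -> R -> R -> R -> R,
  forall (Pi : nat -> seq R) (z : R -> 'cV[R]_K)
         (y : R -> R) (y' : R -> 'M[R]_(1, K)),
    vanishing_partitions T Pi ->
    holder T alpha z ->
    scaled_var_path Pi gamma T z ->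
    controlled T alpha z (path1 y) y' ->
    let zcov k l := scaled_cov Pi gamma (coord_path z k) (coord_path z l) in
    let zcov_n k l n :=
      scaled_cov_n Pi gamma (coord_path z k) (coord_path z l) n in
    let yy k l := fun r : R => y' r 0 k * y' r 0 l in
    let J t := \sum_(k < K) \sum_(l < K) RSint (yy k l) (zcov k l) 0 t in
    [/\ scaled_var_path Pi gamma T (path1 y),
        forall t, 0 <= t <= T ->
          (forall k l, RS_integrable (yy k l) (zcov k l) 0 t) /\
          scaled_cov Pi gamma y y t = J t &
        forall t eps, 0 <= t <= T -> 0 < eps ->
          \forall n \near \oo,
            `|scaled_cov_n Pi gamma y y n t - J t| <=
            C eps (holder_norm T alpha z) (total_scaled_var Pi gamma z T)
                  (holder_norm T alpha y')
                  (holder2_seminorm T (2 * alpha) (remainder z (path1 y) y'))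
            * (mesh 0 (Pi n) `^ (gamma + 3 * alpha - 1) +
               \big[Num.max/0]_(k < K) \big[Num.max/0]_(l < K)
                 sup_norm t (zcov_n k l n \- zcov k l) `^ (alpha - eps))].
Proof.
have alpha_gt0 : 0 < alpha by apply: lt_trans alpha_gt; rewrite divr_gt0.
have T_ge0 := ltW T_gt0.
exists (fun eps Z V Y S =>
  let B := 2 * V + 1 in
  increment_bound T alpha K Z Y S * T +
  K%:R * (K%:R * (rate_constant T alpha (2 * Y * Y) (Y * Y) B * B `^ eps))).
move=> Pi z y y' [Pi_partition Pi_mesh] z_holder z_var [_ y'_holder r_holder].
move=> zcov zcov_n yy J.
set Z := holder_norm T alpha z; set Y := holder_norm T alpha y'.
set S := holder2_seminorm _ _ _.
have Z_ge0 : 0 <= Z by exact: holder_norm_ge0.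
have Y_ge0 : 0 <= Y by exact: holder_norm_ge0.
have S_ge0 : 0 <= S by exact: holder2_seminorm_ge0.
have zk_holder k : holder_bound T alpha Z (coord_path z k).
  move=> s t s_ge0 st tT.
  apply: le_trans (holder_le_norm z_holder s_ge0 st tT).
  by apply: le_trans (le_mx_norm (z t - z s) k 0); rewrite !mxE.
have y'k_holder k : holder_bound T alpha Y (fun r => y' r 0 k).
  move=> s t s_ge0 st tT.
  apply: le_trans (holder_le_norm y'_holder s_ge0 st tT).
  by apply: le_trans (le_mx_norm (y' t - y' s) 0 k); rewrite !mxE.
have y'k_bounded k s : 0 <= s <= T -> `|y' s 0 k| <= Y.
  move=> sT; apply: le_trans (le_mx_norm (y' s) 0 k) _.
  exact: holder_sup_le_norm.
have y_controlled s t : 0 <= s -> s < t -> t <= T ->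
    `|y t - y s - \sum_(k < K) y' s 0 k * (coord_path z k t - coord_path z k s)|
      <= S * (t - s) `^ (2 * alpha).
  move=> s_ge0 st tT; apply: le_trans (holder2_le_seminorm r_holder s_ge0 st tT).
  apply: le_trans (le_mx_norm _ 0 0); rewrite !mxE eqxx !mulr1n.
  by under [in leRHS]eq_bigr do rewrite !mxE.
have z_cvg k l t : 0 <= t <= T ->
    cvgn (fun n => scaled_cov_n Pi gamma (coord_path z k) (coord_path z l) n t).
  by have [+ _ _] := z_var k l; apply.
pose F := weighted_cov_lim gamma Pi (coord_path z) (fun k r => y' r 0 k).
have F_RSint k l t : 0 <= t <= T -> is_RSint (yy k l) (zcov k l) 0 t (F k l t).
  exact: (weighted_cov_is_RSint T_gt0 alpha_gt0 Pi_partition Y_ge0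
    y'k_holder y'k_bounded z_cvg).
have JE t : 0 <= t <= T -> J t = \sum_(k < K) \sum_(l < K) F k l t.
  move=> tT; apply: eq_bigr => k _; apply: eq_bigr => l _.
  by apply: RSint_eq (F_RSint k l t tT); case/andP: tT.
have covE t : 0 <= t <= T -> scaled_cov Pi gamma y y t = J t.
  move=> tT; rewrite JE//.
  exact: (scaled_cov_controlled T_gt0 alpha_gt0 gamma_alpha Pi_partition Pi_mesh
    Z_ge0 Y_ge0 S_ge0 zk_holder y'k_holder y'k_bounded y_controlled z_cvg).
split.
- move=> i j; have yE k : coord_path (path1 y) k = y.
    by apply/funext => t; rewrite /coord_path /path1 mxE (ord1 k) eqxx.
  have dom := scaled_cov_controlled_dominated T_gt0 alpha_gt0 gamma_alpha
    Pi_partition Pi_mesh Z_ge0 Y_ge0 S_ge0 zk_holder y'k_holder y'k_bounded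
    y_controlled z_cvg.
  rewrite !yE; split.
  + move=> t tT; apply/cvg_ex; eexists.
    exact: (scaled_var_controlled_cvg T_gt0 alpha_gt0 gamma_alpha Pi_partition
      Pi_mesh Z_ge0 Y_ge0 S_ge0 zk_holder y'k_holder y'k_bounded
      y_controlled z_cvg tT).
  + apply: continuous_dominated dom _; first
      by rewrite !mulr_ge0// addr_ge0 ?mulr_ge0 ?powR_ge0.
    move=> t; apply: cvg_big => [|k _]; first exact: add_continuous.
    by have [_ + _] := z_var k k; apply.
  + exact: bounded_variation_dominated dom.
- move=> t tT; split; last exact: covE.
  by move=> k l; exists (F k l t); exact: F_RSint.
- move=> t eps tT eps_gt0; rewrite JE//.
  exact: (scaled_var_rate T_gt0 alpha_gt0 alpha_le gamma_alpha Pi_partition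
    Z_ge0 Y_ge0 S_ge0 zk_holder y'k_holder y'k_bounded y_controlled z_cvg
    tT eps_gt0).
Qed.
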